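(* Let $\mathcal{G}$ be the group fixed in the context. Then $\mathcal{G}$ has no proper subgroup of finite index (and hence has no nontrivial finite quotient). In particular, $\mathcal{G}$ is not virtually torsion-free, not residually finite, and hence not linear over any field.
   Context: For every integer $n\geq 3$ choose an odd prime $p_n>n$ such that $p_m\neq p_n$ for $m\neq n$. Let $V_n=\mathbb{F}_{p_n}^n$ with standard basis $e_1,\ldots,e_n$, let $J_n$ be the linear map of $V_n$ with $J_ne_i=e_{i+1}$ for $1\leq i<n$ and $J_ne_n=0$, and put $P_n=I+J_n$, $Q_n=I+J_n+J_n^2$ in $\mathrm{GL}(V_n)$. Let $L_n=\langle P_n,Q_n\rangle\leq \mathrm{GL}(V_n)$ and $D_n=V_n\rtimes L_n$ (natural action); each $D_n$ is a finite group of odd order. The group $\mathcal{G}$ is a group obtained by applying Obraztsov's embedding theorem to the family $\{D_n\}_{n\geq 3}$ (with a sufficiently large fixed odd integer $q$, e.g. $q>2\cdot 10^{77}$). That is, $\mathcal{G}$ is a countable group such that: (1) every $D_n$ embeds in $\mathcal{G}$ (and is identified with its image) so that $D_i\cap D_j=\{1\}$ for $i\neq j$; (2) $\mathcal{G}$ is simple; (3) $\mathcal{G}$ is generated by any two elements $d_1,d_2$ with $d_1\in D_n\setminus\{1\}$ for some $n$ and $d_2\in \mathcal{G}\setminus D_n$; (4) any proper subgroup of $\mathcal{G}$ is either a cyclic group whose order divides $q$ or is conjugate in $\mathcal{G}$ into some $D_n$; (5) any two distinct maximal subgroups of $\mathcal{G}$ intersect trivially. A group is virtually torsion-free if it has a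 torsion-free subgroup of finite index. A group is linear over a field $F$ if it is isomorphic to a subgroup of $\mathrm{GL}_m(F)$ for some positive integer $m$. *)

(* Defs.v *)
From HB Require Import structures.
From mathcomp Require Import all_boot all_algebra all_fingroup all_character.
From mathcomp Require Import boolp classical_sets functions cardinality.

Set Implicit Arguments.
Unset Strict Implicit.
Unset Printing Implicit Defensive.

Import GRing.Theory.

Section FiniteBlocks.

Variables (p n : nat).

Local Open Scope ring_scope.

(* {'GL_n(p)} consists of matrices of size n.-1.+1, which is n as soon as
   0 < n. Matrices act on the right of row vectors, so J sends e_i to e_(i+1)
   and the last basis vector to 0. *)
Definition Jmx : 'M['F_p]_n.-1.+1 := \matrix_(i, j) (j == i.+1 :> nat)%:R.
Definition Pmx : 'M['F_p]_n.-1.+1 := 1%:M + Jmx.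
Definition Qmx : 'M['F_p]_n.-1.+1 := 1%:M + Jmx + Jmx *m Jmx.

Lemma unip_unit (N : 'M['F_p]_n.-1.+1) :
  (forall i j : 'I_n.-1.+1, (j <= i)%N -> N i j = 0) ->
  1%:M + N \is a GRing.unit.
Proof.
move=> N0; rewrite -[_ \is a _]/(_ \in unitmx) unitmxE -det_tr det_trig.
  rewrite big1 ?unitr1 // => i _.
  by rewrite !mxE eqxx N0 // addr0.
apply/is_trig_mxP => i j ltij.
by rewrite !mxE N0 ?(ltnW ltij) // addr0 -val_eqE /= gtn_eqF.
Qed.

Lemma Jmx_upper (i j : 'I_n.-1.+1) : (j <= i)%N -> Jmx i j = 0.
Proof. by move=> leji; rewrite mxE ltn_eqF. Qed.

Lemma Pmx_unit : Pmx \is a GRing.unit.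
Proof. exact: unip_unit Jmx_upper. Qed.

Lemma Qmx_unit : Qmx \is a GRing.unit.
Proof.
rewrite /Qmx -addrA; apply: unip_unit => i j leji.
rewrite mxE Jmx_upper // add0r mxE big1 // => k _.
case: (leqP k i) => [leki | ltik]; first by rewrite Jmx_upper ?mul0r.
by rewrite [Jmx k j]Jmx_upper ?mulr0 // (leq_trans leji) // ltnW.
Qed.

Definition Pgl : {'GL_n(p)} := FinRing.Unit Pmx_unit.
Definition Qgl : {'GL_n(p)} := FinRing.Unit Qmx_unit.

Definition Lgroup : {group {'GL_n(p)}} := <<[set Pgl; Qgl]>>%G.

Lemma Lgroup_mx_repr : mx_repr Lgroup (@GLval n 'F_p).
Proof. by []. Qed.

Definition Lrepr := MxRepresentation Lgroup_mx_repr.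

(* V_n ><| L_n, with L_n acting on the row space V_n by u |-> u *m A. As the
   library composes maps from left to right, this is the semidirect product
   for the natural left action up to the isomorphism given by inversion. *)
Definition Dgroup : finGroupType := sdprod_by ('MR Lrepr)%gact.

End FiniteBlocks.

Local Open Scope group_scope.
Local Open Scope classical_set_scope.
Local Open Scope card_scope.

Section AbstractGroups.

Variable G : groupType.
Implicit Types H K N M : set G.

Definition is_subgroup H : Prop :=
  [/\ H 1, forall x y, H x -> H y -> H (x * y) & forall x, H x -> H x^-1].

Definition is_proper_subgroup H : Prop := is_subgroup H /\ H <> [set: G].

Definition is_maximal_subgroup M : Prop :=
  is_proper_subgroup M /\
  forall K, is_proper_subgroup K -> M `<=` K -> K = M.

Definition is_normal_subgroup N : Prop :=
  is_subgroup N /\ forall x g, N x -> N (x ^ g).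

Definition is_simple_group : Prop :=
  [set: G] <> [set 1] /\
  forall N, is_normal_subgroup N -> N = [set 1] \/ N = [set: G].

Definition generated_subgroup (A : set G) : set G := smallest is_subgroup A.

Definition cyclic_of_order H (d : nat) : Prop :=
  (exists x, H = generated_subgroup [set x]) /\ H #= `I_d.

Definition left_coset H (x : G) : set G := [set x * h | h in H].

Definition finite_index H : Prop := finite_set (range (left_coset H)).

Definition torsion_free H : Prop :=
  forall x k, H x -> (0 < k)%N -> x ^+ k = 1 -> x = 1.

Definition virtually_torsion_free : Prop :=
  exists H, [/\ is_subgroup H, torsion_free H & finite_index H].

Definition residually_finite : Prop :=
  forall x, x <> 1 ->
  exists N, [/\ is_normal_subgroup N, finite_index N & ~ N x].

Definition linear_over (F : fieldType) : Prop :=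
  exists2 m : nat, (0 < m)%N & exists f : G -> 'M[F]_m,
    [/\ forall x, f x \in unitmx,
        forall x y, f (x * y) = (f x *m f y)%R
      & injective f].

(* [phi n] is the identification of [Dgroup (p n) n] with a subgroup of G;
   only the indices n >= 3 are meaningful *)
Record obraztsov_group (p : nat -> nat) (q : nat)
    (phi : forall n, {multiplicative (Dgroup (p n) n) -> G}) : Prop := {
  obraztsov_countable : countable [set: G];
  obraztsov_inj : forall n, (3 <= n)%N -> injective (phi n);
  obraztsov_disjoint : forall i j, (3 <= i)%N -> (3 <= j)%N -> i <> j ->
    range (phi i) `&` range (phi j) = [set 1];
  obraztsov_simple : is_simple_group;
  obraztsov_gen : forall n d1 d2, (3 <= n)%N ->
    range (phi n) d1 -> d1 <> 1 -> ~ range (phi n) d2 ->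
    generated_subgroup [set d1; d2] = [set: G];
  obraztsov_proper : forall H, is_proper_subgroup H ->
    (exists2 d, cyclic_of_order H d & (d %| q)%N) \/
    (exists n g, (3 <= n)%N /\ forall x, H x -> range (phi n) (x ^ g));
  obraztsov_maximal : forall M1 M2,
    is_maximal_subgroup M1 -> is_maximal_subgroup M2 -> M1 <> M2 ->
    M1 `&` M2 = [set 1]
}.

End AbstractGroups.

(* Main.v *)
Require Import Defs.
From HB Require Import structures.
From mathcomp Require Import all_boot all_algebra all_fingroup all_solvable all_character.
From mathcomp Require Import boolp classical_sets functions cardinality.

(** Two features of G drive everything: it is simple, and it contains the
    elementary abelian groups V_n of order p_n ^ n for unboundedly many n.

    The second feature makes G infinite. A subgroup H of finite index makes G
    act on the finite set G / H, and the kernel of this action is a normal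
    subgroup contained in H. If H is proper, simplicity forces this kernel to
    be trivial, so that G embeds in a finite set of maps, which is absurd
    ([finite_index_embedding], [obraztsov_no_finite_embedding]). The same
    dichotomy, applied to the kernel of a morphism to a finite group, excludes
    nontrivial finite quotients. A torsion-free subgroup of finite index would
    be G itself, which contains the torsion elements of V_3; a normal subgroup
    of finite index that avoids some element would be proper.

    Nonlinearity could be deduced from the theorem of Malcev that finitely
    generated linear groups are residually finite. The groups V_n give a more
    direct argument: over a field whose characteristic is not p, an elementary
    abelian p-group of matrices of size m is a subgroup of a product of at most
    m cyclic groups of order p, by Maschke's theorem and Schur's lemma, so its
    rank is at most m ([abelem_faithful_logn_leq]). The primes p_n being
    distinct, at most one of them is the characteristic of a given field, so
    some V_n with n > m has no faithful representation of degree m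
    ([obraztsov_not_linear]). *)

Set Implicit Arguments.
Unset Strict Implicit.
Unset Printing Implicit Defensive.

Local Open Scope group_scope.

(** * Elementary abelian groups of matrices *)

(** The group acts through a faithful irreducible representation of the
    quotient by the kernel. By Schur's lemma an abelian group with such a
    representation is cyclic, and a cyclic elementary abelian p-group has order
    1 or p. *)
Lemma abelem_irr_card_leq (F : fieldType) (gT : finGroupType) (p : nat)
    (E : {group gT}) (m : nat) (rE : mx_representation F E m) :
  prime p -> p.-abelem E -> mx_irreducible rE -> (#|E| <= p * #|rker rE|)%N.
Proof.
move=> p_pr abelE irrE; set K := rker_group rE.
have nKE : E \subset 'N(K) := rker_norm rE.
have irrEK : mx_irreducible (kquo_repr rE) by apply/quo_mx_irr.
have abelEK : p.-abelem (E / K) by apply: quotient_abelem.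
have cycEK : cyclic (E / K).
  exact: mx_faithful_irr_abelian_cyclic (kquo_mx_faithful rE) irrEK
         (abelem_abelian abelEK).
rewrite -(Lagrange (normal_sub (rker_normal rE))) mulnC leq_mul2r.
rewrite -card_quotient //; apply/orP; right.
have [-> | ntEK] := eqVneq (E / K) 1; first by rewrite cards1 prime_gt0.
by rewrite (cyclic_abelem_prime abelEK cycEK ntEK).
Qed.

(** Subgroups of index at most [c] intersect in a subgroup whose index is at
    most the product of the bounds. The index is avoided in favour of orders,
    so that the product formula for [A i * B] applies directly. *)
Lemma card_bigcap_leq (gT : finGroupType) (I : eqType) (E : {group gT})
    (A : I -> {group gT}) (c : nat) (s : seq I) :
  (forall i, A i \subset E) -> (forall i, #|E| <= c * #|A i|)%N ->
  (#|E| <= c ^ size s * #|\bigcap_(i <- s) A i :&: E|)%N.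
Proof.
move=> sAE leEA; elim: s => [|i s IHs] /=.
  by rewrite big_nil finset.setTI expn0 mul1n.
have [B defB] : exists B : {group gT}, \bigcap_(j <- s) A j :&: E = B.
  suffices [C ->] : exists C : {group gT}, \bigcap_(j <- s) A j = C.
    by exists (C :&: E)%G.
  elim/big_ind: _ => [|_ _ [C1 ->] [C2 ->]|i' _]; first by exists [set: gT]%G.
    by exists (C1 :&: C2)%G.
  by exists (A i').
rewrite big_cons -finset.setIA defB in IHs *.
have leAB : (#|A i| * #|B| <= #|E| * #|A i :&: B|)%N.
  rewrite mul_cardG leq_mul2r subset_leq_card ?orbT // mul_subG //.
  by rewrite -defB subsetIr.
rewrite -(leq_pmul2l (cardG_gt0 E)).
apply: leq_trans (leq_mul (leEA i) IHs) _.
by rewrite mulnACA -expnS [leqRHS]mulnCA leq_mul2l leAB orbT.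
Qed.

(** By Maschke's theorem the space is a direct sum of simple modules, of which
    there are at most [m]. The kernels of the actions on these summands have
    index at most [p] and intersect trivially, so the order is at most
    [p ^ m]. *)
Lemma abelem_faithful_logn_leq (F : fieldType) (gT : finGroupType) (p : nat)
    (E : {group gT}) (m : nat) (rE : mx_representation F E m) :
  prime p -> p \notin [pchar F]%R -> p.-abelem E -> mx_faithful rE ->
  (logn p #|E| <= m)%N.
Proof.
move=> p_pr charF'p abelE ffulE; have pE := abelem_pgroup abelE.
have charF'E : [pchar F]%R^'.-group E.
  by apply: sub_pgroup pE => r /eqP->.
have := mx_reducible_semisimple (mxmodule1 rE) (mx_Maschke_pchar rE charF'E).
apply=> -[I U W simU defW dxW].
have leI : (#|I| <= m)%N.
  rewrite -(mxrank1 F m) -defW (mxdirectP dxW) /= -sum1_card leq_sum // => i _.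
  by rewrite lt0n mxrank_eq0; case: (simU i).
pose A i := rstab_group rE (U i).
have leA i : (#|E| <= p * #|A i|)%N.
  have [Umod _ _] := simU i.
  rewrite -[gval (A i)](rker_submod Umod); apply: abelem_irr_card_leq => //.
  exact/submod_mx_irr.
have := card_bigcap_leq (index_enum I) (fun i => rstab_sub rE (U i)) leA.
suffices /trivgP-> : \bigcap_i A i :&: E \subset [1].
  have [n] := p_natP pE.
  rewrite cards1 muln1 => ->; rewrite pfactorK // leq_exp2l ?prime_gt1 //.
  by move/leq_trans; apply; rewrite -[index_enum I]enumT -cardE.
apply: fintype.subset_trans ffulE.
apply/fintype.subsetP => x /finset.setIP[/finset.bigcapP Ax Ex].
apply/setIdP; split=> //.
(* an element that fixes each summand pointwise acts as the identity *)
suffices : (W <= kermx (rE x - 1%:M)%R)%MS.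
  by rewrite defW => /sub_kermxP/eqP; rewrite mulmxBr mulmx1 GRing.subr_eq0.
apply/sumsmx_subP => i _; apply/sub_kermxP.
have /setIdP[_ /eqP Uix] := Ax i isT.
by rewrite mulmxBr mulmx1 Uix GRing.subrr.
Qed.

(** The map [g] is a faithful representation of the additive group of the row
    space, which is elementary abelian of rank [n]. *)
Lemma injective_rV_unitmx_leq (F : fieldType) (p n m : nat)
    (g : 'rV['F_p]_n -> 'M[F]_m) :
  prime p -> p \notin [pchar F]%R -> (forall u, g u \in unitmx) ->
  (forall u v, g (u + v)%R = (g u *m g v)%R) -> injective g -> (n <= m)%N.
Proof.
move=> p_pr charF'p gU gD g_inj.
have g0 : g 0%R = (1%:M)%R.
  by rewrite -[RHS](mulVmx (gU 0%R)) -{3}[0%R]GRing.addr0 gD mulKmx.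
have gR : mx_repr [set: 'rV['F_p]_n]%G g by split=> // u v _ _; apply: gD.
have gker : mx_faithful (MxRepresentation gR).
  apply/fintype.subsetP => u /rkerP[_ gu1]; rewrite inE; apply/eqP/g_inj.
  by rewrite [LHS]gu1 -g0.
have := abelem_faithful_logn_leq p_pr charF'p (mx_Fp_abelem 1 n p_pr) gker.
by rewrite cardsT card_mx card_Fp // mul1n pfactorK.
Qed.

(** * Morphisms of groups *)

Lemma multiplicative1 (G H : groupType) (f : {multiplicative G -> H}) : f 1 = 1.
Proof. by apply: (mulgI (f 1)); rewrite -gmulfM !mulg1. Qed.

(** A multiplicative map between groups, repackaged as a morphism of unital
    magmas so that the theory of group morphisms applies to it. *)
Definition group_morphism (G H : groupType) (f : {multiplicative G -> H}) :
    UMagmaMorphism.type G H :=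
  HB.pack (Multiplicative.sort f) (isMultiplicative.Build G H f gmulfM)
    (Multiplicative_isUMagmaMorphism.Build G H f (multiplicative1 f)).

Lemma kernel_normal (G H : groupType) (f : UMagmaMorphism.type G H) :
  is_normal_subgroup [set x | f x = 1]%classic.
Proof.
split; first split.
- exact: gmulf1.
- by move=> x y /= fx fy; rewrite gmulfM fx fy mulg1.
- by move=> x /= fx; rewrite gmulfV fx invg1.
- by move=> x g /= fx; rewrite gmulfJ fx conj1g.
Qed.

(** * The elementary abelian subgroups *)

Section DgroupTranslations.

Variables p n : nat.

Definition translation (u : 'rV['F_p]_n.-1.+1) : Dgroup p n :=
  sdpair1 ('MR (Lrepr p n))%gact u.

Lemma translationD u v : translation (u + v)%R = translation u * translation v.
Proof. by rewrite -morphM ?inE. Qed.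

Lemma translation0 : translation 0%R = 1.
Proof. exact: morph1. Qed.

Lemma translation_inj : injective translation.
Proof.
by move=> u v /(injmP (injm_sdpair1 ('MR (Lrepr p n))%gact)); apply; rewrite inE.
Qed.

End DgroupTranslations.

(** A faithful representation of degree [m] restricts to each V_n, so that
    every prime p_n with n > m must be the characteristic of the field. Two
    such indices contradict the distinctness of the primes. *)
Lemma obraztsov_not_linear (p : nat -> nat) (q : nat) (G : groupType)
    (phi : forall n, {multiplicative (Dgroup (p n) n) -> G}) (F : fieldType) :
  (forall n, (3 <= n)%N -> prime (p n)) ->
  (forall m n, (3 <= m)%N -> (3 <= n)%N -> m <> n -> p m <> p n) ->
  obraztsov_group q phi -> ~ linear_over G F.
Proof.
move=> p_pr p_inj G_obr [m _ [f [fU fM f_inj]]].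
have small n : (3 <= n)%N -> p n \notin [pchar F]%R -> (n <= m)%N.
  move=> n_ge3 charF'p; rewrite -(prednK (ltnW (ltnW n_ge3))).
  apply: (@injective_rV_unitmx_leq F (p n) _ _
            (fun u => f (phi n (translation u)))) => // [|u v|].
  - exact: p_pr.
  - by rewrite translationD gmulfM fM.
  - move=> u v /f_inj/(obraztsov_inj G_obr n_ge3).
    exact: translation_inj.
have charp n : (m < n)%N -> (3 <= n)%N -> p n \in [pchar F]%R.
  by move=> ltmn n_ge3; apply: contraLR ltmn; rewrite -leqNgt; apply: small.
have := charp (m + 3) _ (leq_addl _ _); rewrite -addn1 leq_add2l => /(_ isT).
have := charp (m + 4) _ (leq_trans _ (leq_addl _ _)).
rewrite -[m.+1]addn1 leq_add2l => /(_ isT isT) /GRing.pcharf_eq charF.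
rewrite charF => /eqP; apply: p_inj; rewrite ?leq_addl //.
  exact: leq_trans (leq_addl m 4).
by move=> /addnI.
Qed.

Local Open Scope classical_set_scope.

(** The group is infinite since V_n has at least p_n > n elements. *)
Lemma obraztsov_no_finite_embedding (p : nat -> nat) (q : nat) (G : groupType)
    (phi : forall n, {multiplicative (Dgroup (p n) n) -> G}) (T : finType)
    (f : G -> T) :
  (forall n, (3 <= n)%N -> prime (p n)) ->
  (forall n, (3 <= n)%N -> (n < p n)%N) ->
  obraztsov_group q phi -> ~ injective f.
Proof.
move=> p_pr p_gt G_obr f_inj; pose n := (#|T| + 3)%N.
have n_ge3 : (3 <= n)%N by apply: leq_addl.
have leT : (#|{: 'rV['F_(p n)]_n.-1.+1}| <= #|T|)%N.
  apply: (leq_card (fun u => f (phi n (@translation (p n) n u)))) => u v.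
  by move=> /f_inj/(obraztsov_inj G_obr n_ge3); apply: translation_inj.
have := p_gt n n_ge3; apply/negP; rewrite -leqNgt.
apply: leq_trans (leq_trans leT (leq_addr 3 _)).
rewrite card_mx card_Fp ?p_pr // mul1n -{1}[p n]expn1 leq_exp2l //.
exact: prime_gt1 (p_pr n n_ge3).
Qed.

(** * The action on the cosets of a subgroup of finite index *)

Lemma left_cosetM (G : groupType) (H : set G) (g x : G) :
  left_coset H (g * x) = [set g * y | y in left_coset H x].
Proof.
by rewrite /left_coset image_comp; apply: eq_imagel => h _ /=; rewrite mulgA.
Qed.

(** The kernel of the action by left multiplication on G / H, that is, the
    normal core of H. *)
Definition coset_kernel (G : groupType) (H : set G) : set G :=
  [set g | forall x, left_coset H (g * x) = left_coset H x].

Lemma coset_kernel_normal (G : groupType) (H : set G) :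
  is_normal_subgroup (coset_kernel H).
Proof.
split; first split.
- by move=> x; rewrite mul1g.
- by move=> g h Kg Kh x; rewrite -mulgA Kg Kh.
- by move=> g Kg x; rewrite -Kg mulgA mulgV mul1g.
- by move=> g h Kg x; rewrite conjgE -!mulgA left_cosetM Kg -left_cosetM mulKg.
Qed.

(** An element of the kernel fixes the coset H itself. *)
Lemma coset_kernel_sub (G : groupType) (H : set G) :
  is_subgroup H -> coset_kernel H `<=` H.
Proof.
move=> [H1 _ _] g /(_ 1); rewrite mulg1 => gH.
have : left_coset H g g by exists 1 => //; rewrite mulg1.
by rewrite gH => -[h Hh <-]; rewrite mul1g.
Qed.

(** When the action on the finite set of cosets is faithful, an element is
    determined by the permutation that it induces. *)
Lemma finite_index_embedding (G : groupType) (H : set G) :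
  finite_index H -> coset_kernel H = [set 1] ->
  exists (T : finType) (f : G -> T), injective f.
Proof.
move=> /finite_seqP[s def_s] K1.
pose act (g : G) (C : set G) := [set g * y | y in C].
(* Cosets are encoded by their position in [s]. The target has one more value
   because [index] returns [size s] on sets outside of [s]. *)
exists {ffun 'I_(size s) -> 'I_(size s).+1}.
exists (fun g => [ffun i : 'I_(size s) =>
  inord (index (act g (nth set0 s i)) s)]) => g h.
move=> /ffunP eq_gh.
have in_s x : left_coset H x \in s.
  have : range (left_coset H) (left_coset H x) by [].
  by rewrite def_s.
suffices : coset_kernel H (g^-1 * h).
  by rewrite K1 /= => /eqP; rewrite mulg_eq1 => /eqP/invg_inj.
move=> x.
have lt_x : (index (left_coset H x) s < size s)%N by rewrite index_mem.
have := eq_gh (Ordinal lt_x); rewrite !ffunE /= nth_index // /act -!left_cosetM.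
move=> /(congr1 val); rewrite /= !inordK ?ltnS ?index_size // => eq_i.
have eq_x : left_coset H (h * x) = left_coset H (g * x).
  by rewrite -[LHS](nth_index set0 (in_s _)) -eq_i nth_index.
by rewrite -mulgA left_cosetM eq_x -left_cosetM mulKg.
Qed.

(** * Finite index, finite quotients and linearity *)

Theorem corollary2p6
  (p : nat -> nat)
  (p_prime : forall n, (3 <= n)%N -> prime (p n))
  (p_odd : forall n, (3 <= n)%N -> odd (p n))
  (p_gt : forall n, (3 <= n)%N -> (n < p n)%N)
  (p_inj : forall m n, (3 <= m)%N -> (3 <= n)%N -> m <> n -> p m <> p n)
  (q : nat) (q_odd : odd q) (q_large : (2 * 10 ^ 77 < q)%N)
  (G : groupType)
  (phi : forall n, {multiplicative (Dgroup (p n) n) -> G})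
  (G_obraztsov : obraztsov_group q phi) :
  (forall H : set G, is_proper_subgroup H -> ~ finite_index H) /\
  (forall (K : finGroupType) (f : {multiplicative G -> K}),
     (forall y : K, exists x : G, f x = y) -> forall y : K, y = 1) /\
  ~ virtually_torsion_free G /\
  ~ residually_finite G /\
  (forall F : fieldType, ~ linear_over G F).
Proof.
have [ntG normalG] := obraztsov_simple G_obraztsov.
have no_emb (T : finType) (f : G -> T) : ~ injective f.
  exact: obraztsov_no_finite_embedding G_obraztsov.
have no_index (H : set G) : is_proper_subgroup H -> ~ finite_index H.
  move=> [sgH ntH] finH; have [K1|KT] := normalG _ (coset_kernel_normal H).
    by have [T [f]] := finite_index_embedding finH K1; apply: no_emb.
  by apply: ntH; apply/seteqP; split=> // x _; apply: coset_kernel_sub; rewrite ?KT.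
have finT (H : set G) : is_subgroup H -> finite_index H -> H = [set: G].
  by move=> sgH finH; apply: contrapT => ntH; apply: no_index finH.
split=> //; split; last split; last split.
- move=> K f f_surj y; pose g := group_morphism f.
  have [N1 | NT] := normalG _ (kernel_normal g).
    case: (no_emb K g); apply: gmulf_inj => x gx1.
    by have : [set x | g x = 1] x by []; rewrite N1.
  have [x <-] := f_surj y; rewrite -[f x]/(g x).
  by have : [set x | g x = 1] x by rewrite NT.
- move=> [H [sgH tfH finH]].
  pose u : 'rV['F_(p 3)]_3.-1.+1 := const_mx 1%R.
  have ntu : phi 3 (translation u) <> 1.
    rewrite -(multiplicative1 (phi 3)) => /(obraztsov_inj G_obraztsov (leqnn 3)).
    rewrite -translation0 => /translation_inj/matrixP/(_ ord0 ord0).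
    by move=> /eqP; rewrite !mxE GRing.oner_eq0.
  apply: ntu; apply: (tfH _ #[translation u]).
  - by rewrite (finT H sgH finH).
  - exact: order_gt0.
  - rewrite -[phi 3 _]/(group_morphism (phi 3) _) -gmulfXn expg_order.
    exact: gmulf1.
- move=> rfG; apply: ntG; apply/seteqP; split=> // x _.
  apply: contrapT => /rfG[N [[sgN _] finN]]; apply.
  by rewrite (finT N sgN finN).
- by move=> F; apply: obraztsov_not_linear G_obraztsov.
Qed.
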